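(* Let $\mu$ be a (positive Borel) measure on $\mathbb{R}$ that is non-degenerate in degree $d\geq 1$. There is a unique (up to scaling) polynomial $F\in\mathbb{R}[\mathbf{x},\mathbf{y}]$ of (total) degree $2d$ with the following property: for all $x,y\in\mathbb{R}$, $F(x,y)=0$ if and only if there is a Gaussian quadrature rule for $\mu$ of degree $2d$ with nodes $r_1=x,\ r_2=y,\ r_3,\ldots,r_{d+1}$ in $\mathbb{R}\cup\{\infty\}$. This polynomial (suitably scaled) has the following two determinantal representations: (a) the determinant of a $d\times d$ matrix with bilinear entries in $\mathbf{x},\mathbf{y}$: $$F=\det\bigl(\mathbf{x}\mathbf{y}\,M_{d-1}-(\mathbf{x}+\mathbf{y})M'_{d-1}+M''_{d-1}\bigr);$$ (b) with this same $F$, the determinant of a $(2d+1)\times(2d+1)$ matrix with linear entries in $\mathbf{x},\mathbf{y}$: $$(\mathbf{x}-\mathbf{y})\cdot F=c\cdot\det\begin{pmatrix}\frac{\det M_{d-1}}{\det M_d}(\mathbf{x}-\mathbf{y}) & e_d^T & e_d^T\\ e_d & \mathbf{x}M_{d-1}-M'_{d-1} & 0\\ e_d & 0 & -\mathbf{y}M_{d-1}+M'_{d-1}\end{pmatrix},$$ where $e_d=(0,\ldots,0,1)^T\in\mathbb{R}^d$ and $c=(-1)^d\det(M_d)/\det(M_{d-1})^2$. Moreover, for all $x\in\mathbb{R}$ with $\det(xM_{d-1}-M'_{d-1})\neq 0$, all nodes of the associated quadrature rule (the Gaussian quadrature rule for $\mu$ of degree $2d$ having $x$ as one of its nodes) lie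 on the real line, i.e., this quadrature rule has no node at infinity.
   Context: $\mathbb{R}[\mathbf{t}]_{\leq D}$ denotes the vector space of real univariate polynomials of degree at most $D$. For $k\in\mathbb{N}_0$, $m_k=\int \mathbf{t}^k\,d\mu$ is the $k$th moment of $\mu$, if it exists and is finite. Evaluations: for $f=\sum_{k=0}^D f_k\mathbf{t}^k\in\mathbb{R}[\mathbf{t}]_{\leq D}$, put $\mathrm{ev}_x(f)=f(x)$ for $x\in\mathbb{R}$ and $\mathrm{ev}_\infty(f)=\mathrm{ev}_\infty^D(f)=f_D$. Quadrature rule: if the moments of $\mu$ up to degree $D$ exist and are finite, a quadrature rule of degree $D$ for $\mu$ is a finite set $N\subset\mathbb{R}\cup\{\infty\}$ together with a function $w\colon N\to\mathbb{R}_{>0}$ such that $\int f\,d\mu=\sum_{x\in N}w(x)\,\mathrm{ev}_x(f)$ for all $f\in\mathbb{R}[\mathbf{t}]_{\leq D}$ (with $\mathrm{ev}_\infty=\mathrm{ev}_\infty^D$). The elements of $N$ are its nodes. A Gaussian quadrature rule of degree $D$ for $\mu$ is a quadrature rule of degree $D$ for $\mu$ with the fewest possible nodes; for $D=2d$ and $\mu$ non-degenerate in degree $d$ this fewest number is $d+1$. Non-degeneracy: $\mu$ is non-degenerate in degree $d$ if its moments $m_k$ are finite for all $k\leq 2d$ and $\int f\,d\mu>0$ for every nonzero $f\in\mathbb{R}[\mathbf{t}]_{\leq 2d}$ that is nonnegative on $\mathbb{R}$. Matrices: $M_d=(m_{i+j-2})_{1\leq i,j\leq d+1}$ is $(d+1)\times(d+1)$,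 and $M_{d-1}=(m_{i+j-2})_{1\leq i,j\leq d}$, $M'_{d-1}=(m_{i+j-1})_{1\leq i,j\leq d}$, $M''_{d-1}=(m_{i+j})_{1\leq i,j\leq d}$ are $d\times d$. *)

(* Defs.v *)
From HB Require Import structures.
From mathcomp Require Import all_boot all_order all_algebra finmap.
From mathcomp Require Import all_classical all_reals all_analysis.
(* The notations of mpoly clash with those of MathComp-Analysis. *)
From mathcomp Require Import -(notations) mpoly.

Set Implicit Arguments.
Unset Strict Implicit.
Unset Printing Implicit Defensive.

Import Order.TTheory GRing.Theory Num.Theory.

Local Open Scope ring_scope.

Notation borel_measure R := {measure set (measurableTypeR R) -> \bar R}.

Section Quadrature.
Variables (R : realType) (mu : borel_measure R).

Definition finite_moments (D : nat) : Prop :=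
  forall k, (k <= D)%N ->
    mu.-integrable setT (EFin \o (fun t : measurableTypeR R => (t : R) ^+ k)).

Definition moment (k : nat) : R :=
  Rintegral mu setT (fun t : measurableTypeR R => (t : R) ^+ k).

Definition integral_poly (f : {poly R}) : R :=
  Rintegral mu setT (fun t : measurableTypeR R => f.[t : R]).

Definition nondegenerate_in_degree (d : nat) : Prop :=
  finite_moments (2 * d) /\
  forall f : {poly R}, (size f <= (2 * d).+1)%N -> f != 0 ->
    (forall t : R, 0 <= f.[t]) -> 0 < integral_poly f.

(* A point of the extended line: [Some x] is the real number x and [None] is
   infinity, where evaluation in degree D is the coefficient of degree D. *)
Definition ev (D : nat) (z : option R) (f : {poly R}) : R :=
  if z is Some x then f.[x] else f`_D.

(* [domf Q] is the set of nodes and Q itself is the weight function. *)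
Definition quadrature_rule (D : nat) (Q : {fmap option R -> R}) : Prop :=
  [/\ finite_moments D,
      forall z : domf Q, 0 < Q z
    & forall f : {poly R}, (size f <= D.+1)%N ->
        integral_poly f = \sum_(z : domf Q) Q z * ev D (val z) f].

Definition gaussian_rule (D : nat) (Q : {fmap option R -> R}) : Prop :=
  quadrature_rule D Q /\
  forall Q' : {fmap option R -> R}, quadrature_rule D Q' ->
    (#|` domf Q| <= #|` domf Q'|)%N.

(* The nodes are pairwise distinct, so x = y is excluded. *)
Definition gaussian_through (d : nat) (x y : R) : Prop :=
  exists Q : {fmap option R -> R}, gaussian_rule (2 * d) Q /\
  exists s : seq (option R), let r := [:: Some x, Some y & s] in
    [/\ size r = d.+1, uniq r & domf Q =i r].

(* [mpoly.msize F] is one more than the total degree of a nonzero F. *)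
Definition node_polynomial (d : nat) (F : mpoly 2 R) : Prop :=
  mpoly.msize F = (2 * d).+1 /\
  forall x y : R,
    meval (tnth [tuple x; y]) F = 0 <-> gaussian_through d x y.

(* [hankel n s] is the n x n matrix with entries m_(i+j+s), indices from 0. *)
Definition hankel (n s : nat) : 'M[R]_n := \matrix_(i, j) moment (i + j + s).

End Quadrature.

Section Determinants.
Variables (R : realType) (mu : borel_measure R) (d : nat).

Definition varx : mpoly 2 R := mpolyX R (mnm1 ord0).
Definition vary : mpoly 2 R := mpolyX R (mnm1 ord_max).

Definition const_mpoly_mx (m n : nat) (A : 'M[R]_(m, n)) :
    'M[mpoly 2 R]_(m, n) :=
  map_mx (@mpolyC 2 R) A.

Let M : 'M[R]_d := hankel mu d 0.
Let M' : 'M[R]_d := hankel mu d 1.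
Let M'' : 'M[R]_d := hankel mu d 2.
Let detMd : R := \det (hankel mu d.+1 0).

Definition bilinear_mx : 'M[mpoly 2 R]_d :=
  (varx * vary) *: const_mpoly_mx M - (varx + vary) *: const_mpoly_mx M'
  + const_mpoly_mx M''.

Definition last_basis_vector : 'cV[mpoly 2 R]_d :=
  \col_i ((i.+1 == d)%:R).

Definition linear_mx : 'M[mpoly 2 R]_(1 + (d + d)) :=
  let e := last_basis_vector in
  block_mx
    ((\det M / detMd) *: (varx - vary))%:M  (row_mx e^T e^T)
    (col_mx e e)
    (block_mx (varx *: const_mpoly_mx M - const_mpoly_mx M') 0
              0 (- (vary *: const_mpoly_mx M) + const_mpoly_mx M')).

Definition linear_mx_scale : R := (-1) ^+ d * detMd / (\det M) ^+ 2.

End Determinants.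

(* Main.v *)
(* Let L be integration against mu and let h be a nonzero polynomial of degree
   at most d+1 with L (h p) = 0 for all p of degree < d.  Then h has distinct
   real roots, at least d of them, for otherwise some p would make L (h p) the
   integral of a nonzero polynomial of constant sign.  Lagrange interpolation
   at these roots, together with the node at infinity when h has degree d, is a
   Gaussian rule, and every Gaussian rule arises in this way.  Such an h
   vanishing at x and y is (X - x)(X - y) q with q of degree < d, and q exists
   exactly when the Gram matrix of (p, q) |-> L ((X - x)(X - y) p q) is
   singular; its determinant is F.  For fixed x the analogous matrix for X - x
   detects the node at infinity.

   The arrow determinant reduces to F because M'' - M' M^-1 M' is a multiple of
   the last diagonal matrix unit.

   If G vanishes wherever F does, then for all but finitely many x the
   univariate F(x, -) has d distinct real roots, all of them roots of G(x, -),
   so F divides P(x)^k G, where P is the leading coefficient of F in y.  By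
   symmetry F divides P(y)^l G, hence F divides G; comparing degrees, G is a
   scalar multiple of F. *)

Require Import Defs.
From HB Require Import structures.
From mathcomp Require Import all_boot all_order all_algebra finmap.
From mathcomp Require Import all_classical all_reals all_analysis.
From mathcomp Require Import -(notations) mpoly.
From mathcomp Require Import ring zify perm polyXY.

Set Implicit Arguments.
Unset Strict Implicit.
Unset Printing Implicit Defensive.

Import Order.TTheory GRing.Theory Num.Theory.

Local Open Scope ring_scope.

(** * Real roots and signs of polynomials *)

Lemma root_factorization (R : fieldType) (h : {poly R}) : h != 0 ->
  exists s (g : {poly R}), h = \prod_(a <- s) ('X - a%:P) * g
    /\ forall a, ~~ root g a.
Proof.
have [n] := ubnP (size h); elim: n h => // n IHn h hn h0.
have [[a ha]|no_root] := pselect (exists a, root h a); last first.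
  exists [::], h; rewrite big_nil mul1r; split=> // a.
  by apply/negP => ha; apply: no_root; exists a.
have /factor_theorem[k hk] := ha.
have k0 : k != 0 by apply: contra_neq h0 => k0; rewrite hk k0 mul0r.
have [|s [g [ks gr]]] := IHn k _ k0.
  by move: hn; rewrite hk size_Mmonic ?monicXsubC // size_XsubC addn2.
by exists (a :: s), g; rewrite big_cons hk {1}ks mulrC mulrA.
Qed.

(** By the intermediate value theorem [g] keeps the sign of [g.[0]], which therefore serves as the
    scaling factor. *)
Lemma rootless_sign (R : rcfType) (g : {poly R}) : (forall a, ~~ root g a) ->
  exists2 c : R, c != 0 & forall t, 0 < (c *: g).[t].
Proof.
move=> gr; have g0 t : g.[t] != 0 by exact: gr.
exists g.[0] => // t; rewrite hornerZ lt_neqAle eq_sym mulf_neq0 //=.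
rewrite leNgt; apply/negP => neg.
have ivt a b : a <= b -> g.[a] * g.[b] < 0 -> False.
  move=> ab; have [ga|ga|ga] := ltgtP g.[a] 0; last by rewrite ga mul0r ltxx.
    rewrite nmulr_rlt0 // => gb.
    have [|x _] := @poly_ivt _ g a b ab; first by rewrite !ltW.
    by apply/negP.
  rewrite pmulr_rlt0 // => gb.
  have [|x _] := @poly_ivt _ (- g) a b ab.
    by rewrite !hornerN oppr_le0 oppr_ge0 !ltW.
  by rewrite rootN; apply/negP.
have [t0|/ltW t0] := leP 0 t; first exact: ivt t0 neg.
by apply: ivt t0 _; rewrite mulrC.
Qed.

(** * Positive functionals, abstracting integration against a non-degenerate measure *)

Definition positive_functional (R : numDomainType) (d : nat)
    (L : {poly R} -> R) :=
  forall f : {poly R}, (size f <= (2 * d).+1)%N -> f != 0 ->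
    (forall t, 0 <= f.[t]) -> 0 < L f.

(** Since [size] exceeds the degree by one, the test polynomials have degree below [d]. *)
Definition orthogonal_upto (R : nzRingType) (d : nat) (L : {poly R} -> R)
    (h : {poly R}) :=
  forall p : {poly R}, (size p <= d)%N -> L (h * p) = 0.

Lemma size_mulp_leq (R : nzSemiRingType) (p q : {poly R}) m n k :
  (size p <= m)%N -> (size q <= n)%N -> (m + n <= k.+1)%N ->
  (size (p * q)%R <= k)%N.
Proof.
by move=> pm qn mn; rewrite (leq_trans (size_polyMleq _ _)) //; lia.
Qed.

Notation vanishing s := (\prod_(a <- s) ('X - a%:P)).

Section PositiveFunctional.
Variables (R : rcfType) (d : nat) (L : {scalar {poly R}}).
Hypothesis L_pos : positive_functional d L.

Lemma positive_functional_sqr (f : {poly R}) :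
  (size f <= d.+1)%N -> f != 0 -> 0 < L (f ^+ 2).
Proof.
move=> sf f0; apply: L_pos; last by move=> t; rewrite hornerE sqr_ge0.
  by rewrite expr2 (size_mulp_leq sf sf) //; lia.
by rewrite expf_neq0.
Qed.

(** Otherwise [h] could be tested against itself, and [L] would vanish at a nonzero square. *)
Lemma size_orthogonal (h : {poly R}) : h != 0 -> orthogonal_upto d L h ->
  (d < size h)%N.
Proof.
move=> h0 ho; rewrite ltnNge; apply/negP => sh.
have := @positive_functional_sqr h _ h0.
by rewrite expr2 ho // ltxx => /(_ (leqW sh)).
Qed.

(* A double root [a] would make [h / ('X - a)] a test polynomial on which the
   functional takes the value of a square; a rootless nonconstant factor [g]
   would do the same with test polynomial [h / g]. *)
Lemma orthogonal_split (h : {poly R}) : h != 0 -> (size h <= d.+2)%N ->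
  orthogonal_upto d L h ->
  exists s, [/\ uniq s, h = lead_coef h *: vanishing s
                & (d <= size s <= d.+1)%N].
Proof.
move=> h0 sh ho; have [s [g [hE gr]]] := root_factorization h0.
have sizeE : size h = (size s + size g)%N.
  have g0 : g != 0 by apply: contra_neq h0 => g0; rewrite hE g0 mulr0.
  by rewrite hE size_monicM ?monic_prod_XsubC // size_prod_XsubC.
have g1 : size g = 1%N.
  have [c c0 gpos] := rootless_sign gr.
  have g0 : g != 0 by apply: contra_neq h0 => g0; rewrite hE g0 mulr0.
  have g2 : size g <> 2%N.
    move=> g2; have [|x] := @poly2_root _ g; first by rewrite g2.
    by apply/negP.
  have [|sg] := ltnP 2 (size g); last first.
    by move: g0 g2 sg; rewrite -size_poly_eq0; case: size => [|[|[|]]].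
  (* Now [g] has degree at least 2, which leaves fewer than [d] entries in [s]: their vanishing
     polynomial is an admissible test polynomial. *)
  move=> sg; have sd : (size s < d)%N by lia.
  pose k : {poly R} := vanishing s.
  have sk : size k = (size s).+1 by rewrite size_prod_XsubC.
  have := @L_pos (c *: (h * k)).
  rewrite linearZ /= ho ?mulr0 ?ltxx; last by rewrite sk.
  move=> F; suff : false by []. apply: F.
  - rewrite size_scale // (size_mulp_leq sh (leqnn _)) //.
    by rewrite sk; lia.
  - by rewrite scaler_eq0 (negPf c0) mulf_neq0 // monic_neq0 //
      monic_prod_XsubC.
  - move=> t; have -> : c *: (h * k) = (c *: g) * k ^+ 2.
      by rewrite hE -/k -!mul_polyC; ring.
    by rewrite hornerM horner_exp mulr_ge0 ?sqr_ge0 // ltW.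
have gc : g = (lead_coef h)%:P.
  rewrite hE lead_coef_monicM ?monic_prod_XsubC //.
  by have /size_poly1P[c c0 ->] := introT eqP g1; rewrite lead_coefC.
exists s; split; last first.
  have := size_orthogonal h0 ho; move: sh.
  by rewrite sizeE g1 !addn1 !ltnS => -> ->.
- by rewrite -mul_polyC -gc mulrC.
- apply/negPn/negP => us.
  have [a [s' ps]] : exists a s', perm_eq s [:: a, a & s'].
    move: us; elim: (s) => //= a u IH; rewrite negb_and negbK => /orP[ua|/IH].
      by exists a, (rem a u); rewrite perm_cons perm_to_rem.
    move=> [b [v uv]]; exists b, (a :: v).
    rewrite (perm_trans (_ : perm_eq _ (a :: [:: b, b & v]))) ?perm_cons //.
    by rewrite -(perm_catCA [:: b; b] [:: a] v).
  pose k : {poly R} := vanishing s'.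
  have sE : size s = (size s').+2 by rewrite (perm_size ps).
  have := @positive_functional_sqr (lead_coef h *: (('X - a%:P) * k)).
  have -> : (lead_coef h *: (('X - a%:P) * k)) ^+ 2 = h * (lead_coef h *: k).
    rewrite {2}hE gc (perm_big _ ps) !big_cons /= -/k -!mul_polyC; ring.
  rewrite ho ?ltxx.
    move=> F; suff : false by []. apply: F.
      rewrite size_scale ?lead_coef_eq0 // size_Mmonic ?monic_prod_XsubC //.
        by rewrite size_XsubC size_prod_XsubC; lia.
      by rewrite polyXsubC_eq0.
    rewrite scaler_eq0 lead_coef_eq0 (negPf h0) mulf_neq0 ?polyXsubC_eq0 //.
    by rewrite monic_neq0 // monic_prod_XsubC.
  by rewrite (leq_trans (size_scale_leq _ _)) // size_prod_XsubC; lia.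
Qed.
End PositiveFunctional.

(** * Lagrange interpolation *)

Section Lagrange.
Variables (R : fieldType) (s : seq R).
Hypothesis s_uniq : uniq s.

Definition lagrange_basis (a : R) : {poly R} :=
  (vanishing (rem a s)).[a]^-1 *: vanishing (rem a s).

Lemma root_vanishing (t : seq R) (a : R) : ((vanishing t).[a] == 0) = (a \in t).
Proof. by rewrite -/(root _ a) root_prod_XsubC. Qed.

Lemma lagrange_basisE a b : a \in s -> b \in s ->
  (lagrange_basis a).[b] = (b == a)%:R.
Proof.
move=> sa sb; rewrite hornerZ; have [->|ba] := eqVneq b a.
  by rewrite mulVf // root_vanishing mem_rem_uniq // !inE eqxx.
by rewrite (eqP (_ : _.[b] == 0)) ?mulr0 // root_vanishing mem_rem_uniq //
  !inE ba.
Qed.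

Lemma size_lagrange_basis a : a \in s ->
  (size (lagrange_basis a) <= size s)%N.
Proof.
move=> sa; rewrite (leq_trans (size_scale_leq _ _)) // size_prod_XsubC.
by rewrite size_rem // prednK //; case: (s) sa.
Qed.

(** The difference of [f] and its interpolant vanishes on [s]. The truncated subtraction forces
    [p = 0] when [size f <= size s]. *)
Lemma lagrange_division (f : {poly R}) : exists p : {poly R},
  f = \sum_(a <- s) f.[a] *: lagrange_basis a + vanishing s * p
  /\ (size p <= size f - size s)%N.
Proof.
set I := \sum_(a <- s) _.
have sI : (size I <= size s)%N.
  rewrite /I big_seq; apply: (leq_trans (size_sum _ _ _)).
  apply/bigmax_leqP_seq => a sa _.
  by rewrite (leq_trans (size_scale_leq _ _)) // size_lagrange_basis.
have dv : vanishing s %| f - I.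
  rewrite uniq_roots_dvdp ?uniq_rootsE //; apply/allP => b sb.
  rewrite /root hornerD hornerN subr_eq0; apply/eqP.
  rewrite /I horner_sum (bigD1_seq b) //= hornerZ lagrange_basisE // eqxx mulr1.
  rewrite big_seq_cond big1 ?addr0 // => a /andP[sa ab].
  by rewrite hornerZ lagrange_basisE // eq_sym (negPf ab) mulr0.
exists ((f - I) %/ vanishing s); split.
  by rewrite mulrC divpK // addrC subrK.
rewrite size_divp ?monic_neq0 ?monic_prod_XsubC // size_prod_XsubC /=.
have := size_polyD f (- I); rewrite size_polyN.
move: sI; move: (size I) (size (f - I)) (size f) (size s) => i k m n.
by rewrite leq_max; lia.
Qed.
End Lagrange.

(** * Quadrature rules for an arbitrary functional *)

Section Rules.
Variable R : realType.

(** This is [quadrature_rule] without the condition on moments, so that any map [M] can stand in for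
    the integral. *)
Definition rule_for (D : nat) (M : {poly R} -> R) (Q : {fmap option R -> R}) :=
  (forall z : domf Q, 0 < Q z) /\
  forall f : {poly R}, (size f <= D.+1)%N ->
    M f = \sum_(z : domf Q) Q z * ev D (val z) f.

Lemma rule_of_seq (D : nat) (M : {poly R} -> R) (r : seq (option R))
    (w : option R -> R) : uniq r -> (forall z, z \in r -> 0 < w z) ->
  (forall f : {poly R}, (size f <= D.+1)%N ->
    M f = \sum_(z <- r) w z * ev D z f) ->
  exists Q : {fmap option R -> R}, [/\ rule_for D M Q, domf Q =i r
    & #|` domf Q| = size r].
Proof.
move=> ur w0 Mf; exists [fmap z : seq_fset tt r => w (val z)].
have pr : perm_eq (seq_fset tt r) r.
  by rewrite (perm_trans (seq_fset_perm tt r)) // undup_id.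
split; last by rewrite /= (perm_size pr).
  split=> [z|f /Mf ->].
    by rewrite ffunE w0 // -(perm_mem pr) (valP z).
  rewrite -(perm_big _ pr) big_seq_fsetE /=.
  by apply: eq_bigr => z _; rewrite ffunE.
by move=> z /=; rewrite (perm_mem pr).
Qed.
End Rules.

(** * Gaussian rules and their vanishing polynomials *)

Section GaussRules.
Variables (R : realType) (d : nat) (L : {scalar {poly R}}).
Hypothesis L_pos : positive_functional d L.

(** Infinity fills the gap when there are only [d] real nodes, so that the total is [d + 1] for both
    admissible sizes of [s]. *)
Definition extended_nodes (s : seq R) : seq (option R) :=
  [seq Some a | a <- s] ++ (if size s == d then [:: None] else [::]).

(** The remainder in [lagrange_division] is the vanishing polynomial times a test polynomial, and
    [L] kills it. *)
Lemma lagrange_quadrature (s : seq R) (f : {poly R}) : uniq s ->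
  orthogonal_upto d L (vanishing s) -> (size f <= d + size s)%N ->
  L f = \sum_(a <- s) f.[a] * L (lagrange_basis s a).
Proof.
move=> us so sf; have [p [fE sp]] := lagrange_division us f.
rewrite {1}fE raddfD /= so ?addr0; last first.
  by rewrite (leq_trans sp) // leq_subLR addnC.
by rewrite raddf_sum; apply: eq_bigr => a _; exact: linearZ.
Qed.

(** The basis polynomial and its square agree at all nodes, and the quadrature formula is exact for
    both; so the weight is the value of [L] at a nonzero square. *)
Lemma lagrange_weight_gt0 (s : seq R) (a : R) : uniq s ->
  (d <= size s <= d.+1)%N -> orthogonal_upto d L (vanishing s) ->
  a \in s -> 0 < L (lagrange_basis s a).
Proof.
move=> us /andP[ds sd] so sa.
have sl := size_lagrange_basis sa.
have -> : L (lagrange_basis s a) = L (lagrange_basis s a ^+ 2).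
  rewrite (lagrange_quadrature us so) 1?(lagrange_quadrature us so).
  - apply: eq_big_seq => b sb; congr (_ * _).
    rewrite horner_exp lagrange_basisE //.
    by case: eqP; rewrite ?expr1n ?expr0n.
  - by rewrite expr2 (size_mulp_leq sl sl) // -addSn leq_add2r.
  - by rewrite (leq_trans sl) // leq_addl.
apply: (positive_functional_sqr L_pos); first exact: leq_trans sl sd.
apply/eqP => l0; have := lagrange_basisE us sa sa.
by rewrite l0 horner0 eqxx => /eqP; rewrite eq_sym oner_eq0.
Qed.

Lemma gauss_rule_of_nodes (s : seq R) : uniq s ->
  (d <= size s <= d.+1)%N -> orthogonal_upto d L (vanishing s) ->
  exists Q : {fmap option R -> R}, [/\ rule_for (2 * d) L Q,
    domf Q =i extended_nodes s & #|` domf Q| = d.+1].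
Proof.
move=> us /[dup] ds /andP[ds1 ds2] so.
pose w z :=
  if z is Some a then L (lagrange_basis s a) else L (vanishing s ^+ 2).
have sz : size (extended_nodes s) = d.+1.
  rewrite size_cat size_map; case: eqP => [->|/eqP ne] /=; rewrite ?addn1 //.
  by apply/eqP; rewrite addn0 eqn_leq ds2 ltn_neqAle ds1 eq_sym ne.
have [| |f sf|Q [Q1 Q2 Q3]] := @rule_of_seq R (2 * d) L (extended_nodes s) w.
- rewrite cat_uniq map_inj_uniq ?us; last by move=> a b [].
  by case: eqP => //= _; rewrite orbF andbT; apply/mapP => -[].
- move=> [a|]; rewrite mem_cat => /orP[/mapP[b sb //]|].
  + by move=> [->]; apply: lagrange_weight_gt0.
  + by case: eqP.
  + case: eqP => // sd _; apply: (positive_functional_sqr L_pos).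
      by rewrite size_prod_XsubC sd.
    by rewrite monic_neq0 // monic_prod_XsubC.
- rewrite big_cat big_map /=; case: eqP => [sd|/eqP sd]; last first.
    rewrite big_nil addr0 (lagrange_quadrature us so).
      by apply: eq_bigr => a _; rewrite mulrC.
    by rewrite (leq_trans sf) //; lia.
  (* With only [d] real nodes the formula is exact up to degree [2 * d - 1]. The monic [V] of degree
     [2 * d] vanishes at every real node, so subtracting a multiple of it lowers the degree and
     keeps the node values; [L V] becomes the weight at infinity. *)
  pose V := vanishing s ^+ 2; pose g := f - f`_(2 * d) *: V.
  have Vm : V \is monic by rewrite monic_exp // monic_prod_XsubC.
  have sV : size V = (2 * d).+1.
    rewrite /V expr2 size_Mmonic ?monic_neq0 ?monic_prod_XsubC //.
    by rewrite size_prod_XsubC sd addSn addnS addnn mul2n.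
  have sg : (size g <= d + size s)%N.
    rewrite sd addnn -mul2n; apply/leq_sizeP => j.
    rewrite leq_eqVlt coefB coefZ.
    case/orP=> [/eqP <-|jd].
      by move/monicP: Vm; rewrite lead_coefE sV /= => ->; rewrite mulr1 subrr.
    by rewrite [f`_j]nth_default ?(leq_trans sf) // [V`_j]nth_default ?sV //
      mulr0 subrr.
  have -> : L f = L g + f`_(2 * d) * L V.
    rewrite -[in LHS](subrK (f`_(2 * d) *: V) f) raddfD.
    by congr (_ + _); exact: linearZ.
  rewrite big_seq1 (lagrange_quadrature us so sg) [X in _ + X]mulrC.
  congr (_ + _); apply: eq_big_seq => a sa; rewrite mulrC; congr (_ * _).
  rewrite hornerD hornerN hornerZ horner_exp.
  rewrite (eqP (_ : (vanishing s).[a] == 0)) ?root_vanishing //.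
  by rewrite expr0n mulr0 subr0.
- by exists Q; split; rewrite // Q3.
Qed.

Definition real_nodes (Q : {fmap option R -> R}) : seq R := pmap id (domf Q).

Lemma mem_real_nodes Q a : (a \in real_nodes Q) = (Some a \in domf Q).
Proof. by rewrite mem_pmap map_id. Qed.

Lemma real_nodes_uniq Q : uniq (real_nodes Q).
Proof. by rewrite (@pmap_uniq _ _ id Some) ?fset_uniq // => -[]. Qed.

Lemma size_real_nodes Q :
  #|` domf Q| = (size (real_nodes Q) + (None \in domf Q))%N.
Proof.
rewrite /real_nodes size_pmap /= -(count_predC isSome); congr (_ + _)%N.
rewrite -(count_uniq_mem _ (fset_uniq _)).
by apply: eq_count => -[].
Qed.

(** The product vanishes at the real nodes. If infinity is a node, the size bound drops by one,
    which makes the coefficient of degree [2 * d] zero. *)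
Lemma rule_vanishing (Q : {fmap option R -> R}) (p : {poly R}) :
  rule_for (2 * d) L Q ->
  (size (vanishing (real_nodes Q) * p)%R + (None \in domf Q) <= (2 * d).+1)%N ->
  L (vanishing (real_nodes Q) * p) = 0.
Proof.
move=> [_ QL] sp; rewrite QL; last by rewrite (leq_trans _ sp) // leq_addr.
rewrite big1 // => z _; have zQ := valP z.
case: (val z) zQ => [a|] /= aQ; last first.
  by rewrite nth_default ?mulr0 //; move: sp; rewrite aQ addn1.
rewrite hornerM (eqP (_ : _.[a] == 0)) ?mul0r ?mulr0 //.
by rewrite root_vanishing mem_real_nodes.
Qed.

Lemma size_vanishingM (s : seq R) (p : {poly R}) :
  (size (vanishing s * p)%R <= size s + size p)%N.
Proof. by rewrite (leq_trans (size_polyMleq _ _)) // size_prod_XsubC. Qed.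

(** A rule with at most [d] nodes would give the value 0 to the square of its own vanishing
    polynomial. *)
Lemma rule_card_ge (Q : {fmap option R -> R}) :
  rule_for (2 * d) L Q -> (d < #|` domf Q|)%N.
Proof.
move=> QL; rewrite ltnNge; apply/negP; rewrite size_real_nodes => sQ.
set V := vanishing (real_nodes Q).
have sV : size V = (size (real_nodes Q)).+1 by rewrite size_prod_XsubC.
have := @positive_functional_sqr _ _ _ L_pos V.
rewrite expr2 rule_vanishing // ?ltxx; last first.
  apply: (leq_trans (leq_add (size_vanishingM _ _) (leqnn _))).
  by rewrite sV; lia.
move=> F; suff : false by []. apply: F; last first.
  by rewrite monic_neq0 ?monic_prod_XsubC.
by rewrite sV ltnS (leq_trans _ sQ) // leq_addr.
Qed.

(** Converse to [gauss_rule_of_nodes]: with [d + 1] nodes in all, [rule_vanishing] leaves room for a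
    cofactor of degree below [d]. *)
Lemma gauss_rule_orthogonal (Q : {fmap option R -> R}) :
  rule_for (2 * d) L Q -> #|` domf Q| = d.+1 ->
  orthogonal_upto d L (vanishing (real_nodes Q)).
Proof.
move=> QL cQ p sp; apply: rule_vanishing => //.
apply: (leq_trans (leq_add (size_vanishingM _ _) (leqnn _))).
by rewrite addnAC -size_real_nodes cQ mul2n -addnn -addSn leq_add2l.
Qed.
End GaussRules.

(** * Gram matrices and orthogonality *)

Section Gram.
Variables (R : fieldType) (L : {scalar {poly R}}).

Lemma functionalZ (c : R) (f : {poly R}) : L (c *: f) = c * L f.
Proof. exact: linearZ. Qed.

(** The matrix of the form (p, q) |-> L (g p q) on monomials. It may be rectangular because
    [quasi_orthogonal_exists] takes one more row than columns. *)
Definition gram (g : {poly R}) (m n : nat) : 'M[R]_(m, n) :=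
  \matrix_(i, j) L (g * 'X^i * 'X^j).

(** The row [v] encodes the polynomial [rVpoly v], and by linearity it suffices to test against
    monomials. *)
Lemma gram_kerP (g : {poly R}) (m n : nat) (v : 'rV[R]_m) :
  v *m gram g m n = 0 <->
  forall p : {poly R}, (size p <= n)%N -> L (g * rVpoly v * p) = 0.
Proof.
have vE j : (v *m gram g m n) 0 j = L (g * rVpoly v * 'X^j).
  rewrite mxE /rVpoly poly_def mulr_sumr mulr_suml raddf_sum.
  apply: eq_bigr => i _.
  by rewrite valK mxE -scalerAr -scalerAl; exact/esym/functionalZ.
split=> [v0 p sp|H]; last first.
  by apply/rowP => j; rewrite vE mxE H // size_polyXn.
rewrite -[X in L (_ * X)]coefK poly_def mulr_sumr raddf_sum big1 // => i _.
transitivity (p`_i * L (g * rVpoly v * 'X^i)).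
  by rewrite -scalerAr; exact: functionalZ.
by rewrite -(vE (widen_ord sp i)) v0 mxE mulr0.
Qed.

Lemma gram_ker_exists (g : {poly R}) (m n : nat) (v : 'rV[R]_m) :
  v != 0 -> v *m gram g m n = 0 ->
  exists q : {poly R},
    [/\ q != 0, (size q <= m)%N & orthogonal_upto n L (g * q)].
Proof.
move=> v0 /gram_kerP vg; exists (rVpoly v); split=> //; last exact: size_poly.
by apply: contra_neq v0 => v0; rewrite -[v]rVpolyK v0 linear0.
Qed.

Lemma det_gram_eq0P (g : {poly R}) (n : nat) :
  \det (gram g n n) = 0 <->
  exists q : {poly R},
    [/\ q != 0, (size q <= n)%N & orthogonal_upto n L (g * q)].
Proof.
split=> [/eqP/det0P[v v0 vg]|[q [q0 sq qo]]].
  exact: gram_ker_exists v0 vg.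
apply/eqP/det0P; exists (poly_rV q).
  by apply: contra_neq q0 => q0; rewrite -(poly_rV_K sq) q0 linear0.
by apply/gram_kerP; rewrite poly_rV_K.
Qed.

(** There are [n + 1] unknown coefficients and only [n] linear conditions. *)
Lemma quasi_orthogonal_exists (g : {poly R}) (n : nat) :
  exists q : {poly R},
    [/\ q != 0, (size q <= n.+1)%N & orthogonal_upto n L (g * q)].
Proof.
have k0 : kermx (gram g n.+1 n) != 0.
  rewrite -mxrank_eq0 mxrank_ker -lt0n subn_gt0 ltnS; exact: rank_leq_col.
apply: (@gram_ker_exists _ _ _ (nz_row (kermx (gram g n.+1 n)))).
  by rewrite nz_row_eq0.
by apply/sub_kermxP; rewrite nz_row_sub.
Qed.
End Gram.

(** * Gaussian rules through prescribed nodes *)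

Section GaussThrough.
Variables (R : realType) (d : nat) (L : {scalar {poly R}}).
Hypothesis L_pos : positive_functional d L.

(** Minimality is replaced by a node count; [gaussian_ruleE] shows that the two agree for a
    non-degenerate measure. *)
Definition gauss_rule (Q : {fmap option R -> R}) :=
  rule_for (2 * d) L Q /\ #|` domf Q| = d.+1.

(** By [orthogonal_split], [h] is a multiple of the vanishing polynomial of its distinct real roots.
    In degree [d] there is one root too few, and infinity takes its place. *)
Lemma gauss_rule_of_orthogonal (h : {poly R}) : h != 0 -> (size h <= d.+2)%N ->
  orthogonal_upto d L h ->
  exists Q, [/\ gauss_rule Q, forall a, (Some a \in domf Q) = root h a
    & None \in domf Q = (size h <= d.+1)%N].
Proof.
move=> h0 sh ho; have [s [us hE ds]] := orthogonal_split L_pos h0 sh ho.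
have lh0 : lead_coef h != 0 by rewrite lead_coef_eq0.
have so : orthogonal_upto d L (vanishing s).
  move=> p /ho; rewrite hE -scalerAl linearZ /= => /eqP.
  by rewrite mulf_eq0 (negPf lh0) => /eqP.
have [Q [QL Qs Qc]] := gauss_rule_of_nodes L_pos us ds so.
exists Q; split=> // [a|]; rewrite Qs mem_cat.
  rewrite mem_map; last by move=> ? ? [].
  by rewrite hE rootZ // root_prod_XsubC; case: eqP => //= _; rewrite orbF.
rewrite (_ : None \in map _ _ = false); last by apply/mapP => -[].
rewrite hE size_scale // size_prod_XsubC ltnS /=.
by case/andP: ds => ds _; rewrite eqn_leq ds andbT; case: leqP.
Qed.

Lemma gauss_rule_pairP (x y : R) :
  \det (gram L (('X - x%:P) * ('X - y%:P)) d d) = 0 <->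
  exists Q, [/\ gauss_rule Q, x != y, Some x \in domf Q & Some y \in domf Q].
Proof.
split.
  move=> /det_gram_eq0P[q [q0 sq qo]].
  have [xy|xy] := eqVneq x y.
    (* For [x = y], testing against [q] itself would make [L] vanish at a nonzero square. *)
    have := @positive_functional_sqr _ _ _ L_pos (('X - x%:P) * q).
    rewrite exprMn [_ ^+ 2 in X in _ -> _ -> 0 < L X]expr2 [q ^+ 2]expr2 mulrA.
    rewrite {4}xy qo // ltxx => F; suff : false by []. apply: F.
      by rewrite (size_mulp_leq (leqnn _) sq) // size_XsubC add2n.
    by rewrite mulf_neq0 // polyXsubC_eq0.
  have [|||Q [Qg Qr Qn]] :=
    @gauss_rule_of_orthogonal (('X - x%:P) * ('X - y%:P) * q).
  - by rewrite !mulf_neq0 ?polyXsubC_eq0.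
  - rewrite (size_mulp_leq (leqnn _) sq) // size_monicM ?monicXsubC
      ?polyXsubC_eq0 //.
    by rewrite !size_XsubC.
  - by [].
  by exists Q; split; rewrite ?Qr ?rootM ?root_XsubC ?eqxx ?orbT.
move=> [Q [[QL Qc] xy xQ yQ]]; apply/det_gram_eq0P.
have Vo := gauss_rule_orthogonal QL Qc.
set s := real_nodes Q in Vo.
have ys : y \in rem x s.
  by rewrite mem_rem_uniq ?real_nodes_uniq // !inE eq_sym xy mem_real_nodes.
have ps : perm_eq s [:: x, y & rem y (rem x s)].
  have xs : x \in s by rewrite mem_real_nodes.
  by rewrite (perm_trans (perm_to_rem xs)) // perm_cons perm_to_rem.
(* Removing both nodes from the orthogonal vanishing polynomial leaves a kernel element. *)
exists (vanishing (rem y (rem x s))); split.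
- by rewrite monic_neq0 ?monic_prod_XsubC.
- have := perm_size ps; rewrite size_prod_XsubC /= => sE.
  have : (size s <= d.+1)%N by rewrite -Qc size_real_nodes leq_addr.
  by rewrite sE.
- by move: Vo; rewrite (perm_big _ ps) !big_cons /= mulrA.
Qed.

(** If infinity were a node, only [d - 1] real nodes other than [x] would remain, and their
    vanishing polynomial would lie in the kernel of the Gram matrix. *)
Lemma gauss_rule_noinf (Q : {fmap option R -> R}) (x : R) :
  \det (gram L ('X - x%:P) d d) != 0 -> gauss_rule Q -> Some x \in domf Q ->
  None \notin domf Q.
Proof.
move=> /eqP P0 [QL Qc] xQ; apply/negP => oQ; apply: P0; apply/det_gram_eq0P.
have Vo := gauss_rule_orthogonal QL Qc; set s := real_nodes Q in Vo.
have ps : perm_eq s (x :: rem x s) by rewrite perm_to_rem ?mem_real_nodes.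
exists (vanishing (rem x s)); split.
- by rewrite monic_neq0 ?monic_prod_XsubC.
- have := perm_size ps; rewrite size_prod_XsubC /= => <-.
  by move: Qc; rewrite size_real_nodes oQ addn1 => -[->].
- by move: Vo; rewrite (perm_big _ ps) big_cons.
Qed.

(** A Lagrange basis polynomial isolates one weight. Partial lookup lets two rules be compared
    without transporting nodes between their domains. *)
Lemma gauss_rule_weight (Q : {fmap option R -> R}) (a : R) : gauss_rule Q ->
  None \notin domf Q -> Some a \in domf Q ->
  Q.[? Some a]%fmap = Some (L (lagrange_basis (real_nodes Q) a)).
Proof.
move=> [[_ QL] Qc] oQ aQ; have aQ' := aQ; rewrite -mem_real_nodes in aQ'.
have us := real_nodes_uniq Q.
rewrite QL; last first.
  rewrite (leq_trans (size_lagrange_basis aQ')) //.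
  have : (size (real_nodes Q) <= d.+1)%N.
    by rewrite -Qc size_real_nodes leq_addr.
  by move=> /leq_trans; apply; rewrite ltnS leq_pmull.
rewrite in_fnd (bigD1 (FSetSub aQ)) //= lagrange_basisE // eqxx mulr1.
rewrite big1 ?addr0 // => -[[b|] bQ] za /=; last by case/negP: oQ.
by rewrite lagrange_basisE ?mem_real_nodes // (negPf (_ : b != a)) ?mulr0.
Qed.

Lemma gauss_rule_unique (Q Q' : {fmap option R -> R}) (x : R) :
  \det (gram L ('X - x%:P) d d) != 0 -> gauss_rule Q -> gauss_rule Q' ->
  Some x \in domf Q -> Some x \in domf Q' -> Q = Q'.
Proof.
move=> P0 Qg Qg' xQ xQ'.
have oQ := gauss_rule_noinf P0 Qg xQ; have oQ' := gauss_rule_noinf P0 Qg' xQ'.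
have key T : gauss_rule T -> Some x \in domf T -> None \notin domf T ->
    exists q, [/\ vanishing (real_nodes T) = ('X - x%:P) * q, q \is monic,
      size q = d.+1 & orthogonal_upto d L (('X - x%:P) * q)].
  move=> [TL Tc] xT oT; have Vo := gauss_rule_orthogonal TL Tc.
  set s := real_nodes T in Vo *.
  have ps : perm_eq s (x :: rem x s) by rewrite perm_to_rem ?mem_real_nodes.
  exists (vanishing (rem x s)); split.
  - by rewrite (perm_big _ ps) big_cons.
  - exact: monic_prod_XsubC.
  - have := perm_size ps; rewrite size_prod_XsubC /= => <-.
    by rewrite -Tc size_real_nodes (negPf oT) addn0.
  - by move: Vo; rewrite (perm_big _ ps) big_cons.
have [q [Vq qm sq qo]] := key _ Qg xQ oQ.
have [q' [Vq' qm' sq' qo']] := key _ Qg' xQ' oQ'.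
(* Both cofactors are monic of degree [d]; a nonzero difference would have degree below [d] and lie
   in the kernel. *)
have qq' : q = q'.
  apply/eqP; rewrite -subr_eq0; apply: contraNT P0 => qq'.
  apply/eqP/det_gram_eq0P; exists (q - q'); split=> //.
    apply/leq_sizeP => j; rewrite leq_eqVlt coefB => /orP[/eqP <-|dj].
      have -> : q`_d = lead_coef q by rewrite lead_coefE sq.
      have -> : q'`_d = lead_coef q' by rewrite lead_coefE sq'.
      by rewrite (monicP qm) (monicP qm') subrr.
    by rewrite !nth_default ?subrr ?sq ?sq'.
  by move=> p sp; rewrite mulrBr mulrBl raddfB /= qo // qo' // subrr.
have dQ : domf Q = domf Q'.
  apply/fsetP => -[a|]; last by rewrite (negPf oQ) (negPf oQ').
  by rewrite -!mem_real_nodes -!root_prod_XsubC Vq Vq' qq'.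
have rQ : real_nodes Q = real_nodes Q' by rewrite /real_nodes dQ.
apply/fmapP => -[a|]; last by rewrite !not_fnd.
have memE : (Some a \in domf Q') = (Some a \in domf Q) by rewrite dQ.
have [aQ|aQ] := boolP (Some a \in domf Q); last by rewrite !not_fnd ?memE.
by rewrite !gauss_rule_weight ?memE // rQ.
Qed.

Lemma gauss_rule_exists (x : R) :
  \det (gram L ('X - x%:P) d d) != 0 ->
  exists2 Q, gauss_rule Q & Some x \in domf Q.
Proof.
move=> P0; have [q [q0 sq qo]] := quasi_orthogonal_exists L ('X - x%:P) d.
have [|||Q [Qg Qr _]] := @gauss_rule_of_orthogonal (('X - x%:P) * q).
- by rewrite mulf_neq0 ?polyXsubC_eq0.
- by rewrite (size_mulp_leq (leqnn _) sq) // size_XsubC.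
- by [].
by exists Q; rewrite // Qr rootM root_XsubC eqxx.
Qed.
End GaussThrough.

(** * Moments as a linear functional *)

Definition moment_functional (R : realType) (mu : borel_measure R) (D : nat)
    (f : {poly R}) : R :=
  \sum_(i < D.+1) f`_i * moment mu i.

(** Truncation at degree [D] makes the functional linear on all polynomials, whereas additivity of
    [integral_poly] depends on integrability. *)
Lemma moment_functional_is_linear (R : realType) (mu : borel_measure R)
  (D : nat) : scalar (moment_functional mu D).
Proof.
move=> c f g; rewrite /moment_functional mulr_sumr -big_split /=.
by apply: eq_bigr => i _; rewrite coefD coefZ mulrDl mulrA.
Qed.

HB.instance Definition _ (R : realType) (mu : borel_measure R) (D : nat) :=
  GRing.isLinear.Build R {poly R} R *%R (moment_functional mu D)
    (moment_functional_is_linear mu D).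

Section Moments.
Variables (R : realType) (mu : borel_measure R) (D : nat).
Hypothesis mu_fin : finite_moments mu D.

Lemma integral_polyE (f : {poly R}) : (size f <= D.+1)%N ->
  Defs.integral_poly mu f = moment_functional mu D f.
Proof.
move=> sf; rewrite /Defs.integral_poly.
under eq_Rintegral do rewrite (horner_coef_wide _ sf).
have mT : measurable [set: measurableTypeR R] by [].
pose pw k : measurableTypeR R -> R := fun t => (t : R) ^+ k.
pose S n : measurableTypeR R -> R := fun t => \sum_(i < n) f`_i * pw i t.
have S0 : S 0%N = fun=> 0 by apply/funext => t; rewrite /S big_ord0.
have SS n : S n.+1 = fun t => S n t + f`_n * pw n t.
  by apply/funext => t; rewrite /S big_ord_recr.
(* Integrability is carried along in the induction because additivity of the integral requires
   it. *)
suff H n : (n <= D.+1)%N -> mu.-integrable setT (EFin \o S n) /\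
    Rintegral mu setT (S n) = \sum_(i < n) f`_i * moment mu i.
  by rewrite /moment_functional; have [_ <-] := H _ (leqnn _).
elim: n => [_|n IH nD].
  by rewrite S0 big_ord0 /Rintegral integral0; split; first exact: integrable0.
have [iI eI] := IH (ltnW nD).
have In : mu.-integrable setT (EFin \o (fun t => f`_n * pw n t)).
  have /(integrableZl mT (f`_n)) := mu_fin (nD : (n <= D)%N).
  by apply: eq_integrable => // t _ /=; rewrite EFinM.
rewrite SS; split.
  by have := integrableD mT iI In; apply: eq_integrable => // t _ /=;
    rewrite EFinD.
rewrite RintegralD // eI RintegralZl ?big_ord_recr //.
exact: mu_fin (nD : (n <= D)%N).
Qed.

Lemma quadrature_ruleE (Q : {fmap option R -> R}) :
  quadrature_rule mu D Q <-> rule_for D (moment_functional mu D) Q.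
Proof.
split=> [[_ Qp QL]|[Qp QL]]; split=> // f sf.
  by rewrite -integral_polyE ?QL.
by rewrite integral_polyE ?QL.
Qed.

Lemma moment_functionalXn (k : nat) : (k <= D)%N ->
  moment_functional mu D 'X^k = moment mu k.
Proof.
move=> kD; rewrite /moment_functional (bigD1 (inord k)) //= coefXn inordK //.
rewrite eqxx mul1r big1 ?addr0 // => i ik; rewrite coefXn.
rewrite (negPf (_ : (i : nat) != k)) ?mul0r //.
by apply: contra_neq ik => <-; rewrite inord_val.
Qed.
End Moments.

(** * Gaussian rules and Hankel matrices of a non-degenerate measure *)

Section NondegenerateMeasure.
Variables (R : realType) (mu : borel_measure R) (d : nat).
Hypothesis mu_nondeg : nondegenerate_in_degree mu d.
Local Notation L := (moment_functional mu (2 * d)).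

Lemma moment_functional_positive : positive_functional d L.
Proof.
case: mu_nondeg => mf mp f sf f0 fp.
by rewrite -(integral_polyE mf sf) mp.
Qed.

(** The minimum is [d + 1]: [rule_card_ge] bounds it from below, and an orthogonal polynomial of
    degree at most [d] produces a rule attaining it. *)
Lemma gaussian_ruleE (Q : {fmap option R -> R}) :
  gaussian_rule mu (2 * d) Q <-> gauss_rule d L Q.
Proof.
case: (mu_nondeg) => mf _.
have [q [q0 sq qo]] := quasi_orthogonal_exists L 1 d.
have [|||Q0 [Q0g _ _]] := @gauss_rule_of_orthogonal _ _ _
   moment_functional_positive (1 * q).
- by rewrite mul1r.
- by rewrite mul1r (leq_trans sq).
- by [].
split=> [[/(quadrature_ruleE mf) QL Qm]|[QL Qc]].
  split=> //; apply/eqP; rewrite eqn_leq.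
  rewrite (rule_card_ge moment_functional_positive QL) andbT.
  by case: (Q0g) => Q0L <-; apply: Qm; apply/(quadrature_ruleE mf).
split; first exact/(quadrature_ruleE mf).
move=> Q' /(quadrature_ruleE mf) Q'L; rewrite Qc.
exact: (rule_card_ge moment_functional_positive).
Qed.

Lemma gaussian_throughE (x y : R) :
  gaussian_through mu d x y <->
  \det (gram L (('X - x%:P) * ('X - y%:P)) d d) = 0.
Proof.
rewrite (gauss_rule_pairP moment_functional_positive).
split=> [[Q [/gaussian_ruleE Qg [s [sr ur Qr]]]]|[Q [Qg xy xQ yQ]]].
  exists Q; split=> //; rewrite ?Qr ?inE ?eqxx ?orbT //.
  by move: ur => /= /andP[]; rewrite inE negb_or => /andP[].
exists Q; split; first exact/gaussian_ruleE.
exists (rem (Some y) (rem (Some x) (domf Q))).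
have ys : Some y \in rem (Some x) (domf Q).
  rewrite mem_rem_uniq ?fset_uniq // !inE yQ andbT.
  by apply: contra_neq xy => -[].
have ps : perm_eq (domf Q) [:: Some x, Some y &
  rem (Some y) (rem (Some x) (domf Q))].
  by rewrite (perm_trans (perm_to_rem xQ)) // perm_cons perm_to_rem.
move=> r; split.
- by rewrite -(perm_size ps); case: Qg.
- by rewrite -(perm_uniq ps) fset_uniq.
- by move=> z; rewrite (perm_mem ps).
Qed.

Lemma gram_pair_hankel (x y : R) :
  gram L (('X - x%:P) * ('X - y%:P)) d d =
  (x * y) *: hankel mu d 0 - (x + y) *: hankel mu d 1 + hankel mu d 2.
Proof.
apply/matrixP => i j; rewrite !mxE.
have -> : ('X - x%:P) * ('X - y%:P) * 'X^i * 'X^j =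
  (x * y) *: 'X^(i + j + 0) - (x + y) *: 'X^(i + j + 1) + 'X^(i + j + 2)
    :> {poly R}.
  rewrite !exprD -!mul_polyC !rmorphM /= rmorphD /=; ring.
rewrite raddfD raddfB /= !linearZ /= !moment_functionalXn //;
  have := ltn_ord i; have := ltn_ord j; lia.
Qed.

Lemma gram_single_hankel (x : R) :
  gram L ('X - x%:P) d d = - (x *: hankel mu d 0 - hankel mu d 1).
Proof.
apply/matrixP => i j; rewrite !mxE.
have -> : ('X - x%:P) * 'X^i * 'X^j = - (x *: 'X^(i + j + 0) - 'X^(i + j + 1))
  :> {poly R}.
  rewrite !exprD -!mul_polyC; ring.
rewrite raddfN raddfB /= !linearZ /= !moment_functionalXn //;
  have := ltn_ord i; have := ltn_ord j; lia.
Qed.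

Lemma gram_one_hankel (n : nat) : (n <= d.+1)%N -> gram L 1 n n = hankel mu n 0.
Proof.
move=> nd; apply/matrixP => i j; rewrite !mxE addn0 /=.
rewrite mul1r -exprD moment_functionalXn //.
by have := ltn_ord i; have := ltn_ord j; lia.
Qed.

(** A kernel vector would be a nonzero polynomial whose square has value 0 under [L]. *)
Lemma det_hankel_neq0 (n : nat) : (n <= d.+1)%N -> \det (hankel mu n 0) != 0.
Proof.
move=> nd; rewrite -gram_one_hankel //.
apply/eqP => /det_gram_eq0P[q [q0 sq qo]].
have sq' := leq_trans sq nd.
have := positive_functional_sqr moment_functional_positive sq' q0.
by rewrite expr2 -[q * q]mul1r mulrA qo // ltxx.
Qed.
End NondegenerateMeasure.

(** * Arrow determinants and Schur complements of Hankel matrices *)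

(* Subtracting the last block column from the middle one, and then the last
   block row from the middle one, turns the middle diagonal block into
   [(x - y) *: M], which is eliminated together with the corner [k (x - y)];
   the division by [x - y] is avoided by scaling the last block column. *)
Lemma det_arrow (S : idomainType) (n : nat) (M Mi M' : 'M[S]_n) (e : 'cV[S]_n)
    (u : 'rV[S]_n) (x y k c : S) :
  M *m Mi = 1%:M -> k * c = 1 -> x != y ->
  \det (block_mx (k * (x - y))%:M (row_mx u u) (col_mx e e)
    (block_mx (x *: M - M') 0 0 (- (y *: M) + M')) : 'M[S]_(1 + (n + n))) =
  (x - y) * k * \det M * (-1) ^+ n *
  \det ((x *: M - M') *m Mi *m (y *: M - M') + c *: (e *m u)).
Proof.
move=> MMi kc xy; have MiM : Mi *m M = 1%:M by exact: mulmx1C.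
set dl := x - y; have dl0 : dl != 0 by rewrite subr_eq0.
set A := x *: M - M'; set B := y *: M - M'.
have -> : - (y *: M) + M' = - B by rewrite opprB addrC.
set N := block_mx _ _ _ _; set F := _ + c *: _.
pose P : 'M[S]_(1 + (n + n)) :=
  block_mx 1%:M 0 0 (block_mx 1%:M (- 1%:M) 0 1%:M).
pose Q : 'M[S]_(1 + (n + n)) :=
  block_mx 1%:M 0 0 (block_mx 1%:M 0 (- 1%:M) 1%:M).
pose W : 'M[S]_(1 + (n + n)) :=
  block_mx 1%:M (row_mx 0 (- (c *: u))) 0 (block_mx 1%:M (- (Mi *m B)) 0 dl%:M).
have AB : A - B = dl *: M by rewrite /A /B opprB addrA subrK scalerBl.
have NE : P *m N *m Q =
    block_mx (k * dl)%:M (row_mx 0 u) (col_mx 0 e)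
      (block_mx (dl *: M) B B (- B)).
  rewrite /P /N /Q !mulmx_block !(mul0mx, mulmx0, mul1mx, mulmx1, addr0, add0r).
  rewrite mul_row_block mul_block_col !mulmx_block.
  rewrite !(mul0mx, mulmx0, mul1mx, mulmx1, mulNmx, mulmxN, addr0, add0r).
  by rewrite !subrr !opprK AB.
have TE : P *m N *m Q *m W =
    block_mx (k * dl)%:M 0 (col_mx 0 e) (block_mx (dl *: M) 0 B (- F)).
  rewrite NE /W !mulmx_block !(mul0mx, mulmx0, mul1mx, mulmx1, addr0, add0r).
  rewrite mul_mx_row mul_row_block mul_col_row add_block_mx.
  rewrite !(mul0mx, mulmx0, mul1mx, mulmx1, mulNmx, mulmxN, addr0, add0r).
  congr block_mx.
    rewrite add_row_mx mul_scalar_mx scalerA mulrAC kc mul1r addr0.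
    by rewrite mul_mx_scalar addNr row_mx0.
  rewrite mul_mx_scalar -scalemxAl mulmxA MMi mul1mx addNr.
  congr block_mx; rewrite -scalemxAr -!opprD /F addrC mulmxA; congr (- (_ + _)).
  rewrite -[A in RHS](subrK B) AB !mulmxDl -!scalemxAl MMi mul1mx.
  by rewrite addrC.
have detP : \det P = 1 by rewrite det_ublock det1 mul1r det_ublock !det1 mul1r.
have detQ : \det Q = 1 by rewrite det_ublock det1 mul1r det_lblock !det1 mul1r.
have detW : \det W = dl ^+ n.
  by rewrite det_ublock det1 mul1r det_ublock det1 mul1r det_scalar.
have := congr1 determinant TE.
rewrite !det_mulmx detP detQ detW mul1r mulr1 det_lblock det_scalar1 det_lblock.
rewrite detZ -scaleN1r detZ => E; apply: (mulIf (expf_neq0 n dl0)).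
rewrite E; ring.
Qed.

Definition last_vector (R : pzSemiRingType) (d : nat) : 'cV[R]_d :=
  \col_i ((i.+1 == d)%:R).

(** Except for the last one, each column of [M'] is the next column of [M], so [M' *m Mi *m M'] has
    there the entries of the twice shifted matrix; the same holds for rows. Only the corner entry
    can differ. *)
Lemma hankel_schur (R : realType) (mu : borel_measure R) (d : nat)
    (Mi : 'M[R]_d) : hankel mu d 0 *m Mi = 1%:M -> (0 < d)%N ->
  hankel mu d 2 = hankel mu d 1 *m Mi *m hankel mu d 1 +
    (\det (hankel mu d.+1 0) / \det (hankel mu d 0)) *:
      (last_vector R d *m (last_vector R d)^T).
Proof.
case: d Mi => // d Mi MMi _; have MiM := mulmx1C MMi.
set M := hankel mu d.+1 0 in MMi MiM *; set M' := hankel mu d.+1 1.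
have detM : \det M != 0 by case: (mulmx1_unit MMi); rewrite unitmxE unitfE.
have shifted_col (i j : 'I_d.+1) : j != ord_max ->
    (M' *m Mi *m M') i j = moment mu (i + j + 2).
  move=> jd; have jd' : (j.+1 < d.+1)%N.
    rewrite ltnS ltn_neqAle -ltnS ltn_ord andbT.
    by apply: contra_neq jd => jd; apply: val_inj.
  transitivity ((M' *m Mi *m M) i (Ordinal jd')).
    rewrite [LHS]mxE [RHS]mxE; apply: eq_bigr => k _; congr (_ * _).
    by rewrite !mxE; congr moment; rewrite /=; lia.
  by rewrite -mulmxA MiM mulmx1 mxE; congr moment; rewrite /=; lia.
have shifted_row (i j : 'I_d.+1) : i != ord_max ->
    (M' *m Mi *m M') i j = moment mu (i + j + 2).
  move=> id; have id' : (i.+1 < d.+1)%N.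
    rewrite ltnS ltn_neqAle -ltnS ltn_ord andbT.
    by apply: contra_neq id => id; apply: val_inj.
  transitivity ((M *m (Mi *m M')) (Ordinal id') j).
    rewrite -mulmxA [LHS]mxE [RHS]mxE; apply: eq_bigr => k _; congr (_ * _).
    by rewrite !mxE; congr moment; rewrite /=; lia.
  by rewrite mulmxA MMi mul1mx mxE; congr moment; rewrite /=; lia.
(* The corner defect is the Schur complement of [M] in the Hankel matrix one size larger; the
   unipotent [U] clears the upper right block. *)
have corner : moment mu (d.*2.+2) - (M' *m Mi *m M') ord_max ord_max =
    \det (hankel mu d.+2 0) / \det M.
  have blockE : hankel mu (d.+1 + 1) 0 = block_mx M (col ord_max M')
      (row ord_max M') (moment mu (d.*2.+2))%:M.
    rewrite -[LHS]submxK; congr block_mx;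
      apply/matrixP => i j; rewrite !mxE //=.
    - by rewrite (ord1 j) /= !addn0 addnS addn1.
    - by rewrite (ord1 i) /= !addn0 addSn addn1.
    - by rewrite (ord1 i) (ord1 j) /= !addn0 addnn doubleS.
  pose U : 'M[R]_(d.+1 + 1) := block_mx 1%:M (- (Mi *m col ord_max M')) 0 1%:M.
  have detU : \det U = 1 by rewrite det_ublock !det1 mul1r.
  have := congr1 determinant (erefl (hankel mu (d.+1 + 1) 0 *m U)).
  rewrite {2}blockE mulmx_block !(mulmx0, mulmx1, addr0) det_mulmx detU mulr1.
  rewrite mulmxN mulmxA MMi mul1mx addNr det_lblock addn1 => ->.
  rewrite det_mx11 mulrC mulKf // [RHS]mxE [X in _ = _ + X]mxE mulr1n addrC.
  congr (_ + _); rewrite mulmxN mulmxA -row_mul [RHS]mxE; congr (- _).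
  rewrite [LHS]mxE [RHS]mxE; apply: eq_bigr => k _.
  by rewrite [col _ _ _ _]mxE [row _ _ _ _]mxE.
have eeE (i j : 'I_d.+1) : (last_vector R d.+1 *m (last_vector R d.+1)^T) i j =
    (i == ord_max)%:R * (j == ord_max)%:R.
  by rewrite mxE big_ord1 !mxE !eqSS.
apply/matrixP => i j; rewrite [LHS]mxE [RHS]mxE [X in _ + X]mxE -corner eeE.
have [->|id] := eqVneq i ord_max; last by rewrite mul0r mulr0 addr0 shifted_row.
have [->|jd] := eqVneq j ord_max; last by rewrite mulr0 mulr0 addr0 shifted_col.
rewrite !mulr1 addrC subrK; congr moment; rewrite /=; lia.
Qed.

(** * Coefficients and degrees of determinants with polynomial entries *)

Lemma poly_eq0_of_values (R : numDomainType) (p : {poly R}) :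
  (forall x, p.[x] = 0) -> p = 0.
Proof.
move=> p0; apply/eqP/negPn/negP => pn.
have us : uniq [seq i%:R : R | i <- iota 0 (size p)].
  by rewrite map_inj_uniq ?iota_uniq // => i j /eqP; rewrite eqr_nat => /eqP.
have ar : all (root p) [seq i%:R : R | i <- iota 0 (size p)].
  by apply/allP => x _; rewrite /root p0.
by have := max_poly_roots pn ar us; rewrite size_map size_iota ltnn.
Qed.

Lemma coef_prod_linear (S : comNzRingType) (n : nat) (f : 'I_n -> {poly S}) :
  (forall i, size (f i) <= 2)%N ->
  (size (\prod_i f i)%R <= n.+1)%N /\ (\prod_i f i)`_n = \prod_i (f i)`_1.
Proof.
elim: n f => [|n IH] f sf; first by rewrite !big_ord0 size_poly1 coef1.
rewrite !big_ord_recr /=.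
have [sp pE] := IH (fun i => f (widen_ord (leqnSn n) i)) (fun i => sf _).
split; first by rewrite (size_mulp_leq sp (sf _)) // addn2.
set p := \prod_(i < n) _ in sp pE *; set q := f ord_max.
have -> : q = q`_1 *: 'X + (q`_0)%:P.
  apply/polyP => -[|[|i]]; rewrite coefD coefZ coefX coefC
    ?mulr0 ?mulr1 ?addr0 ?add0r //=.
  by rewrite nth_default // (leq_trans (sf _)).
rewrite mulrDr -scalerAr coefD coefZ coefMX coefMC /= coefD coefZ coefX coefC.
by rewrite mulr1 addr0 [p`_n.+1]nth_default // mul0r addr0 pE mulrC.
Qed.

(** Every term of the Leibniz expansion is a product of [n] polynomials of degree at most 1. The
    ring is general so that the lemma applies both over [R] and over [{poly R}]. *)
Lemma coef_det_pencil (S : comNzRingType) (n : nat) (A B : 'M[S]_n) :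
  let D := \det ('X *: map_mx polyC A + map_mx polyC B) in
  (size D <= n.+1)%N /\ D`_n = \det A.
Proof.
move=> D; pose M : 'M[{poly S}]_n := 'X *: map_mx polyC A + map_mx polyC B.
have ME i j : M i j = A i j *: 'X + (B i j)%:P.
  by rewrite !mxE mulrC mul_polyC.
have sM i j : (size (M i j) <= 2)%N.
  rewrite ME (leq_trans (size_polyD _ _)) // geq_max.
  by rewrite (leq_trans (size_scale_leq _ _)) ?size_polyX //
    (leq_trans (size_polyC_leq1 _)).
have MP (s : 'S_n) := coef_prod_linear (fun i => sM i (s i)).
split.
  apply: (leq_trans (size_sum _ _ _)); apply/bigmax_leqP => s _.
  by rewrite mulr_sign; case: ifP => _; rewrite ?size_polyN; case: (MP s).
rewrite coef_sum; apply: eq_bigr => s _; rewrite !mulr_sign.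
have [_ E] := MP s.
have -> : \prod_i A i (s i) = (\prod_i M i (s i))`_n.
  rewrite E; apply: eq_bigr => i _.
  by rewrite ME coefD coefZ coefX coefC mulr1 addr0.
by case: ifP; rewrite ?coefN.
Qed.

Lemma msize_prod_leq (R : idomainType) (m n k : nat) (f : 'I_n -> mpoly m R) :
  (forall i, mpoly.msize (f i) <= k.+1)%N ->
  (mpoly.msize (\prod_i f i)%R <= (k * n).+1)%N.
Proof.
elim: n f => [|n IH] f sf; first by rewrite big_ord0 msize1.
rewrite big_ord_recr /=; set p := \prod_(i < n) _.
have sp : (mpoly.msize p <= (k * n).+1)%N by apply: IH => i; apply: sf.
have [->|p0] := eqVneq p 0; first by rewrite mul0r msize0.
have [->|q0] := eqVneq (f ord_max) 0; first by rewrite mulr0 msize0.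
rewrite msizeM //; move: sp (sf ord_max).
move: (mpoly.msize _) (mpoly.msize _) => a b.
by rewrite mulnS; lia.
Qed.

Lemma msize_det_leq (R : idomainType) (m n k : nat) (A : 'M[mpoly m R]_n) :
  (forall i j, mpoly.msize (A i j) <= k.+1)%N ->
  (mpoly.msize (\det A) <= (k * n).+1)%N.
Proof.
move=> sA; apply: (leq_trans (msize_sum _ _ _)); apply/bigmax_leqP => s _.
by rewrite mulr_sign; case: ifP => _; rewrite ?msizeN; apply: msize_prod_leq.
Qed.

Lemma mpoly_rmorph_eq (R S : comNzRingType) (n : nat)
  (f g : {rmorphism mpoly n R -> S}) :
  (forall c, f (mpolyC n c) = g (mpolyC n c)) ->
  (forall i, f (mpolyX R (mnm1 i)) = g (mpolyX R (mnm1 i))) -> f =1 g.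
Proof.
move=> fgC fgX p; rewrite [p]mpolyE !rmorph_sum /=; apply: eq_bigr => m _.
rewrite -mul_mpolyC !rmorphM fgC /= mpolyXE_id !rmorph_prod; congr (_ * _).
by apply: eq_bigr => i _; rewrite !rmorphXn fgX.
Qed.

(** * Bivariate polynomials as nested univariate ones *)

Section Bivariate.
Variable R : realType.

(** The inner variable is x and the outer one is y, so evaluation at (x, y) reads [p.[y%:P].[x]]. *)
Definition nested_var (i : 'I_2) : {poly {poly R}} :=
  if i == ord0 then ('X)%:P else 'X.

Definition nested : mpoly 2 R -> {poly {poly R}} :=
  mmap (@polyC {poly R} \o @polyC R) nested_var.

HB.instance Definition _ := GRing.RMorphism.copy nested
  (mmap (@polyC {poly R} \o @polyC R) nested_var).

Lemma nestedC c : nested (mpolyC 2 c) = c%:P%:P.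
Proof. exact: mmapC. Qed.

Lemma nestedX i : nested (mpolyX R (mnm1 i)) = nested_var i.
Proof. by rewrite /nested mmapX mmap1U. Qed.

Definition unnested_coef : {poly R} -> mpoly 2 R :=
  horner_morph (fun c => mulrC (varx R) (mpolyC 2 c)).

Definition unnested : {poly {poly R}} -> mpoly 2 R :=
  horner_morph (f := unnested_coef) (fun c => mulrC (vary R) (unnested_coef c)).

HB.instance Definition _ := GRing.RMorphism.on unnested_coef.
HB.instance Definition _ := GRing.RMorphism.on unnested.

Lemma unnestedC (q : {poly R}) : unnested q%:P = unnested_coef q.
Proof. exact: horner_morphC. Qed.

Lemma unnested_coefC (c : R) : unnested_coef c%:P = mpolyC 2 c.
Proof. exact: horner_morphC. Qed.

Lemma nestedK : cancel nested unnested.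
Proof.
apply: (@mpoly_rmorph_eq _ _ _ (unnested \o nested) idfun) => [c|i] /=.
  by rewrite nestedC unnestedC unnested_coefC.
rewrite nestedX /nested_var; case: eqP => [->|/eqP i0].
  by rewrite unnestedC; apply: horner_morphX.
transitivity (vary R); first exact: horner_morphX.
by congr (mpolyX _ (mnm1 _)); apply: val_inj; case: i i0 => -[|[|]].
Qed.

Lemma meval_nested (p : mpoly 2 R) (x y : R) :
  meval (tnth [tuple x; y]) p = (nested p).[y%:P].[x].
Proof.
pose ev1 : {rmorphism {poly {poly R}} -> {poly R}} := horner_eval (y%:P).
pose ev2 : {rmorphism {poly R} -> R} := horner_eval x.
apply: (@mpoly_rmorph_eq _ _ _ (meval (tnth [tuple x; y]))
  (ev2 \o (ev1 \o nested))) => [c|i] /=.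
  by rewrite mevalC nestedC /ev1 /ev2 /= /horner_eval !hornerC.
rewrite mevalXU nestedX /ev1 /ev2 /= /horner_eval /nested_var.
have [->|i0] := eqVneq i ord0; first by rewrite hornerC hornerX (tnth_nth 0).
have -> : i = ord_max by apply: val_inj; case: i i0 => -[|[|]].
by rewrite hornerX hornerC (tnth_nth 0).
Qed.

(** One nonzero coefficient bounds the total degree from below, since it must come from the monomial
    with exponents [i] and [j]. *)
Lemma msize_nested_coef (p : mpoly 2 R) (i j : nat) :
  (nested p)`_j`_i != 0 -> (i + j < mpoly.msize p)%N.
Proof.
move=> pij; have : exists2 m, m \in msupp p & (nested (mpolyX R m))`_j`_i != 0.
  apply/hasP; apply: contra_neqT pij => /hasPn H.
  rewrite [p]mpolyE rmorph_sum /= !coef_sum big_seq big1 // => m mp.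
  rewrite -mul_mpolyC rmorphM /= nestedC !coefCM.
  by move/negPn/eqP: (H m mp) => ->; rewrite mulr0.
move=> [m mp mij]; suff mE : mdeg m = (i + j)%N by rewrite -mE msize_mdeg_lt.
move: mij; rewrite mpolyXE_id rmorph_prod big_ord_recl big_ord1 !rmorphXn /=
  !nestedX.
rewrite /nested_var /= -polyC_exp coefCM coefXn.
have [->|_] := eqVneq j (m (lift ord0 ord0)); last by rewrite mulr0 coef0 eqxx.
rewrite mulr1 coefXn; have [->|_] := eqVneq i (m ord0); last by rewrite eqxx.
move=> _; rewrite mdegE big_ord_recl big_ord1.
by congr (_ + m _)%N; apply: val_inj.
Qed.
End Bivariate.

(* [P] in the inner variable and [P] in the outer one are coprime: the latter
   has a leading coefficient in the outer variable that does not involve the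
   inner one, so reduction modulo [P ^+ k] cannot kill it. *)
Lemma two_sided_division (R : fieldType) (P : {poly R}) (k l : nat)
    (f g q r : {poly {poly R}}) : P != 0 -> f != 0 ->
  P ^+ k *: g = q * f -> (map_poly polyC P) ^+ l * g = r * f ->
  exists A, g = A * f.
Proof.
move=> P0 f0 Pg Ug; set D := P ^+ k in Pg;
  set U := (map_poly polyC P) ^+ l in Ug.
have D0 : D != 0 by rewrite expf_neq0.
have lU : lead_coef U = (lead_coef (P ^+ l))%:P.
  by rewrite /U -rmorphXn lead_coef_map_inj //; apply: polyC_inj.
have Uq : U * q = D *: r.
  apply: (mulIf f0); rewrite -mulrA -Pg -scalerAl -Ug -!mul_polyC; ring.
pose A := map_poly (fun c => c %/ D) q; pose B := map_poly (fun c => c %% D) q.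
have cA j : A`_j = q`_j %/ D by rewrite coef_map_id0 // div0p.
have cB j : B`_j = q`_j %% D by rewrite coef_map_id0 // mod0p.
have qE : q = D *: A + B.
  by apply/polyP => j; rewrite coefD coefZ cA cB mulrC -divp_eq.
have UB : U * B = D *: (r - U * A).
  rewrite scalerBr -Uq {1}qE mulrDr -scalerAr; ring.
have B0 : B = 0.
  apply/eqP; rewrite -lead_coef_eq0; apply/negPn/negP => lB0.
  have : D %| lead_coef U * lead_coef B.
    by rewrite -lead_coefM UB lead_coefZ dvdp_mulr.
  rewrite lU mul_polyC dvdpZr ?lead_coef_eq0 ?expf_neq0 // => /(dvdp_leq lB0).
  by rewrite leqNgt lead_coefE cB ltn_modp D0.
exists A; apply: (@mulfI _ (D%:P)); first by rewrite polyC_eq0.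
by rewrite !mul_polyC Pg qE B0 addr0 scalerAl.
Qed.

(** * The node polynomial: zeros, uniqueness and the arrow determinant *)

Section NodePolynomial.
Variables (R : realType) (mu : borel_measure R) (d : nat).
Hypothesis d_gt0 : (0 < d)%N.
Hypothesis mu_nondeg : nondegenerate_in_degree mu d.

Local Notation L := (moment_functional mu (2 * d)).
Local Notation M := (hankel mu d 0).
Local Notation M' := (hankel mu d 1).
Local Notation M'' := (hankel mu d 2).
Local Notation F := (\det (bilinear_mx mu d)).

Let L_pos : positive_functional d L := moment_functional_positive mu_nondeg.

Lemma det_gram_single (x : R) :
  (\det (gram L ('X - x%:P) d d) == 0) = (\det (x *: M - M') == 0).
Proof.
by rewrite gram_single_hankel // -scaleN1r detZ mulf_eq0 expf_eq0 oppr_eq0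
  oner_eq0 andbF.
Qed.

Lemma meval_bilinear (x y : R) : meval (tnth [tuple x; y]) F =
  \det (gram L (('X - x%:P) * ('X - y%:P)) d d).
Proof.
rewrite gram_pair_hankel // -det_map_mx; congr (\det _).
have xE : meval (tnth [tuple x; y]) (varx R) = x.
  by rewrite mevalXU (tnth_nth 0).
have yE : meval (tnth [tuple x; y]) (vary R) = y.
  by rewrite mevalXU (tnth_nth 0).
apply/matrixP => i j; rewrite !mxE.
by rewrite !(rmorphD, rmorphN, rmorphM) /= xE yE !mevalC.
Qed.

Lemma bilinear_zeroE (x y : R) :
  meval (tnth [tuple x; y]) F = 0 <-> gaussian_through mu d x y.
Proof. by rewrite meval_bilinear gaussian_throughE. Qed.

(** The coefficient of y in the bilinear matrix. Its determinant is both the leading coefficient of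
    [F] in y and, up to sign, the Gram determinant that detects a node at infinity. *)
Definition lead_pencil : 'M[{poly R}]_d :=
  'X *: map_mx polyC M + map_mx polyC (- M').
Local Notation P := (\det lead_pencil).

Lemma lead_pencilE (x : R) : P.[x] = \det (x *: M - M').
Proof.
rewrite -/(horner_eval x _) -det_map_mx; congr (\det _).
by apply/matrixP => i j; rewrite !mxE /= /horner_eval !hornerE.
Qed.

Lemma nested_entry (i j : 'I_d) : nested (bilinear_mx mu d i j) =
  ('X%:P * 'X) * (M i j)%:P%:P - ('X%:P + 'X) * (M' i j)%:P%:P
  + (M'' i j)%:P%:P.
Proof.
have xE : nested (varx R) = 'X%:P by rewrite nestedX.
have yE : nested (vary R) = 'X by rewrite nestedX.
rewrite /bilinear_mx !mxE.
by rewrite !(rmorphD, rmorphN, rmorphM) /= xE yE !nestedC.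
Qed.

Lemma nested_bilinear : nested F = \det ('X *: map_mx polyC lead_pencil +
  map_mx polyC (- ('X *: map_mx polyC M') + map_mx polyC M'')).
Proof.
transitivity (\det (map_mx (@nested R) (bilinear_mx mu d))).
  by rewrite det_map_mx.
apply: (congr1 determinant); apply/matrixP => i j.
rewrite mxE nested_entry !mxE !(rmorphD, rmorphN, rmorphM) /=; ring.
Qed.

(** The coefficient of y^d is [P], whose own coefficient of degree [d] is the nonzero determinant of
    [M]. *)
Lemma size_nested_bilinear : size (nested F) = d.+1.
Proof.
have [sf fE] := coef_det_pencil lead_pencil
  (- ('X *: map_mx polyC M') + map_mx polyC M'').
have [_ pE] := coef_det_pencil M (- M').
rewrite -nested_bilinear in sf fE.
apply/eqP; rewrite eqn_leq sf ltnNge; apply/negP => sd.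
move: pE; rewrite -fE [(nested F)`_d]nth_default // coef0 => /esym/eqP.
by apply/negP; apply: (det_hankel_neq0 mu_nondeg).
Qed.

Lemma lead_coef_nested_bilinear : lead_coef (nested F) = P.
Proof.
have [_ fE] := coef_det_pencil lead_pencil
  (- ('X *: map_mx polyC M') + map_mx polyC M'').
by rewrite lead_coefE size_nested_bilinear /= nested_bilinear fE.
Qed.

Lemma lead_pencil_neq0 : P != 0.
Proof.
by rewrite -lead_coef_nested_bilinear lead_coef_eq0 -size_poly_eq0
  size_nested_bilinear.
Qed.

Lemma swapXY_nested_bilinear : swapXY (nested F) = nested F.
Proof.
transitivity (\det (map_mx (@swapXY R) (map_mx (@nested R)
  (bilinear_mx mu d)))).
  by rewrite !det_map_mx.
transitivity (\det (map_mx (@nested R) (bilinear_mx mu d)));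
  last by rewrite det_map_mx.
apply: (congr1 determinant); apply/matrixP => i j.
rewrite [LHS]mxE [in LHS]mxE [RHS]mxE nested_entry !(rmorphD, rmorphN, rmorphM)
  /=.
rewrite swapXY_X !swapXY_polyC map_polyX !map_polyC /=; ring.
Qed.

(** The pseudo-remainder has degree below [d] in y. Where [P.[x]] is nonzero, it vanishes at the [d]
    other nodes of the Gaussian rule through [x], hence identically in y. *)
Lemma bilinear_pseudo_division (g : {poly {poly R}}) :
  (forall x y, (nested F).[y%:P].[x] = 0 -> g.[y%:P].[x] = 0) ->
  exists k q, P ^+ k *: g = q * nested F.
Proof.
move=> fg; set f := nested F in fg *.
have := Pdiv.Idomain.divp_eq g f; rewrite lead_coef_nested_bilinear.
set k := scalp g f; set q := (g %/ f)%R; set r := (g %% f)%R => gE.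
exists k, q; rewrite gE; suff -> : r = 0 by rewrite addr0.
have sr : (size r <= d)%N.
  rewrite -ltnS -size_nested_bilinear Pdiv.Idomain.ltn_modp.
  by rewrite -size_poly_eq0 size_nested_bilinear.
(* Multiplying by [P] disposes of the values of [x] at which [P] vanishes. *)
apply/polyP => j; rewrite coef0; apply: (mulIf lead_pencil_neq0); rewrite mul0r.
apply: poly_eq0_of_values => x; rewrite hornerM.
have [->|Px] := eqVneq P.[x] 0; first by rewrite mulr0.
suff -> : (r`_j).[x] = 0 by rewrite mul0r.
have Gx : \det (gram L ('X - x%:P) d d) != 0.
  by rewrite det_gram_single -lead_pencilE.
have [Q Qg xQ] := gauss_rule_exists L_pos Gx.
have oQ := gauss_rule_noinf Gx Qg xQ.
have xs : x \in real_nodes Q by rewrite mem_real_nodes.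
have us := real_nodes_uniq Q.
have ss : size (rem x (real_nodes Q)) = d.
  rewrite size_rem //; case: Qg => _.
  by rewrite size_real_nodes (negPf oQ) addn0 => ->.
pose rx := map_poly (horner_eval x) r.
have rxE y : rx.[y] = r.[y%:P].[x].
  by rewrite -[y in LHS](hornerC y x) -/(horner_eval x y%:P) horner_map.
have -> : (r`_j).[x] = rx`_j by rewrite coef_map.
suff -> : rx = 0 by rewrite coef0.
apply: (@roots_geq_poly_eq0 _ _ (rem x (real_nodes Q))).
- apply/allP => y ys; rewrite /root rxE.
  have fxy : f.[y%:P].[x] = 0.
    rewrite -meval_nested meval_bilinear; apply/(gauss_rule_pairP L_pos).
    move: ys; rewrite mem_rem_uniq // !inE eq_sym mem_real_nodes.
    by move=> /andP[xy yQ]; exists Q.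
  have := congr1 (fun p : {poly {poly R}} => p.[y%:P].[x]) gE.
  by rewrite -mul_polyC !hornerE fxy fg // !mulr0 add0r => <-.
- by rewrite rem_uniq.
- by rewrite ss (leq_trans (size_poly _ _)).
Qed.

Lemma bilinear_divides (G : mpoly 2 R) :
  (forall x y, meval (tnth [tuple x; y]) F = 0 ->
    meval (tnth [tuple x; y]) G = 0) ->
  exists H, G = H * F.
Proof.
move=> FG; have FG' x y :
    (nested F).[y%:P].[x] = 0 -> (nested G).[y%:P].[x] = 0.
  by rewrite -!meval_nested; apply: FG.
have [k [q kq]] := bilinear_pseudo_division FG'.
(* As [F] is symmetric, exchanging the variables in [G] yields a second division, with a power of
   [P] in y. *)
have [|l [r lr]] := @bilinear_pseudo_division (swapXY (nested G)).
  move=> x y; rewrite -{1}swapXY_nested_bilinear !horner2_swapXY; exact: FG'.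
have lr' : (map_poly polyC P) ^+ l * nested G = swapXY r * nested F.
  have := congr1 (@swapXY R) lr; rewrite -mul_polyC !rmorphM /= swapXYK.
  by rewrite swapXY_nested_bilinear swapXY_polyC rmorphXn.
have f0 : nested F != 0 by rewrite -size_poly_eq0 size_nested_bilinear.
have [A GA] := two_sided_division lead_pencil_neq0 f0 kq lr'.
by exists (unnested A); rewrite -[G]nestedK GA rmorphM /= nestedK.
Qed.

(** Entries have total degree at most 2, which gives the upper bound; the coefficient of x^d y^d is
    the determinant of [M], which gives the lower one. *)
Lemma msize_bilinear : mpoly.msize F = (2 * d).+1.
Proof.
apply/eqP; rewrite eqn_leq; apply/andP; split.
  apply: msize_det_leq => i j; rewrite !mxE.
  have le3 (a b : mpoly 2 R) : (mpoly.msize a <= 3)%N ->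
      (mpoly.msize b <= 3)%N -> (mpoly.msize (a + b)%R <= 3)%N.
    by move=> a3 b3; rewrite (leq_trans (msizeD_le _ _)) // geq_max a3.
  have leC (a : mpoly 2 R) c : (mpoly.msize a <= 3)%N ->
      (mpoly.msize (a * mpolyC 2 c)%R <= 3)%N.
    by move=> a3; rewrite mulrC mul_mpolyC (leq_trans (msizeZ_le _ _)).
  have sx i0 : mpoly.msize (mpolyX R (mnm1 i0) : mpoly 2 R) = 2%N.
    by rewrite msizeX mdeg1.
  have nz i0 : (mpolyX R (mnm1 i0) : mpoly 2 R) != 0.
    by rewrite -msize_poly_eq0 sx.
  apply: (le3); last by rewrite msizeC; case: eqP.
  apply: (le3); first by apply: leC; rewrite msizeM ?nz // !sx.
  rewrite msizeN; apply: leC.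
  by rewrite (leq_trans (msizeD_le _ _)) // geq_max !sx.
rewrite mul2n -addnn msize_nested_coef //.
have -> : (nested F)`_d = P.
  by rewrite -lead_coef_nested_bilinear lead_coefE size_nested_bilinear.
have [_ ->] := coef_det_pencil M (- M').
exact: (det_hankel_neq0 mu_nondeg).
Qed.

Lemma node_polynomial_bilinear : node_polynomial mu d F.
Proof. by split=> [|x y]; [exact: msize_bilinear|exact: bilinear_zeroE]. Qed.

(** [F] divides [G], and equal total degrees force the quotient to be constant. *)
Lemma node_polynomial_unique (G : mpoly 2 R) : node_polynomial mu d G ->
  exists2 c : R, c != 0 & G = c *: F.
Proof.
move=> [sG GE]; have [|H GH] := @bilinear_divides G.
  by move=> x y /bilinear_zeroE /GE.
have G0 : G != 0 by rewrite -msize_poly_eq0 sG.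
have F0 : F != 0 by rewrite -msize_poly_eq0 msize_bilinear.
have H0 : H != 0 by apply: contra_neq G0 => H0; rewrite GH H0 mul0r.
have /eqP/msize_poly1P[c c0 HE] : mpoly.msize H = 1%N.
  by move: sG; rewrite GH msizeM // msize_bilinear addnS /=
    -(add1n (2 * d)%N) => /addIn ->.
by exists c => //; rewrite GH HE mul_mpolyC.
Qed.

Lemma bilinear_arrow : (varx R - vary R) * F =
  linear_mx_scale mu d *: \det (linear_mx mu d).
Proof.
pose c := \det (hankel mu d.+1 0) / \det M.
pose k := \det M / \det (hankel mu d.+1 0).
have M0 : \det M != 0 by apply: (det_hankel_neq0 mu_nondeg).
have Md0 : \det (hankel mu d.+1 0) != 0 by apply: (det_hankel_neq0 mu_nondeg).
have MMi : M *m invmx M = 1%:M by rewrite mulmxV // unitmxE unitfE.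
pose cst : 'M[R]_d -> 'M[mpoly 2 R]_d := map_mx (@mpolyC 2 R).
have cMMi : cst M *m cst (invmx M) = 1%:M by rewrite -map_mxM MMi map_mx1.
have xy : varx R != vary R.
  apply/eqP => /(congr1 (meval (tnth [tuple 1; 0]))).
  by rewrite !mevalXU !(tnth_nth 0) /=; apply/eqP/oner_neq0.
have kc : mpolyC 2 k * mpolyC 2 c = 1 :> mpoly 2 R.
  by rewrite -mpolyCM /k /c mulrA divfK // divff.
pose e := last_basis_vector R d.
(* By [hankel_schur] the bilinear matrix takes the factored form in [det_arrow]; the inverse of [M]
   is taken over [R] and then mapped to constants. *)
have bE : bilinear_mx mu d = (varx R *: cst M - cst M') *m cst (invmx M) *m
    (vary R *: cst M - cst M') + mpolyC 2 c *: (e *m e^T).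
  rewrite /bilinear_mx /const_mpoly_mx -!/(cst _) (hankel_schur MMi d_gt0).
  have -> : cst (M' *m invmx M *m M' +
        c *: (last_vector R d *m (last_vector R d)^T)) =
      cst M' *m cst (invmx M) *m cst M' + mpolyC 2 c *: (e *m e^T).
    rewrite /cst map_mxD map_mxZ !map_mxM -map_trmx.
    have -> // : map_mx (@mpolyC 2 R) (last_vector R d) = e.
    by apply/matrixP => i j; rewrite !mxE; case: eqP; rewrite ?rmorph1 ?rmorph0.
  rewrite addrA; congr (_ + _).
  have cMiM : cst (invmx M) *m cst M = 1%:M by exact: mulmx1C.
  rewrite [(_ - _) *m cst _]mulmxBl -scalemxAl cMMi mulmxBl -scalemxAl mul1mx.
  rewrite scalerBr scalerA [_ *m (_ - _)]mulmxBr -scalemxAr.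
  have -> : cst M' *m cst (invmx M) *m cst M = cst M'.
    by rewrite -mulmxA cMiM mulmx1.
  by rewrite scalerDl !opprD opprK !addrA.
rewrite /linear_mx /linear_mx_scale.
have -> : (\det M / \det (hankel mu d.+1 0)) *: (varx R - vary R) =
  mpolyC 2 k * (varx R - vary R).
  by rewrite mul_mpolyC.
rewrite (det_arrow (cst M') e e^T cMMi kc xy) -bE.
have -> : \det (cst M) = mpolyC 2 (\det M) by rewrite det_map_mx.
have -> : (-1) ^+ d = mpolyC 2 ((-1) ^+ d) :> mpoly 2 R.
  by rewrite rmorphXn rmorphN1.
rewrite -mul_mpolyC -[LHS]mul1r -mpolyC1.
set s := (-1) ^+ d; set D := \det (hankel mu d.+1 0).
(* [linear_mx_scale] cancels exactly the constant factors produced by [det_arrow]. *)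
have -> : 1 = (s * D / \det M ^+ 2) * k * \det M * s :> R.
  have ss : s * s = 1 by rewrite -expr2 sqrr_sign.
  transitivity (s * s); first by rewrite ss.
  by rewrite /k -/D; field; rewrite Md0 M0.
rewrite !mpolyCM; ring.
Qed.
End NodePolynomial.

Theorem theorem4 (R : realType) (mu : borel_measure R) (d : nat)
    (d_ge1 : (1 <= d)%N) (mu_nondeg : nondegenerate_in_degree mu d) :
  (exists F : mpoly 2 R,
    [/\ node_polynomial mu d F,
        forall G : mpoly 2 R, node_polynomial mu d G ->
          exists2 c : R, c != 0 & G = c *: F,
        F = \det (bilinear_mx mu d)
      & (varx R - vary R) * F
        = linear_mx_scale mu d *: \det (linear_mx mu d)])
  /\
  (forall x : R, \det (x *: hankel mu d 0 - hankel mu d 1) != 0 ->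
    exists Q : {fmap option R -> R},
      [/\ gaussian_rule mu (2 * d) Q,
          Some x \in domf Q,
          (forall Q' : {fmap option R -> R},
             gaussian_rule mu (2 * d) Q' -> Some x \in domf Q' -> Q' = Q)
        & None \notin domf Q]).
Proof.
split.
  exists (\det (bilinear_mx mu d)); split=> //.
  - exact: node_polynomial_bilinear.
  - exact: node_polynomial_unique.
  - exact: bilinear_arrow.
move=> x; rewrite -det_gram_single => Px.
have [Q Qg xQ] := gauss_rule_exists (moment_functional_positive mu_nondeg) Px.
exists Q; split=> //.
- exact/gaussian_ruleE.
- move=> Q' /(gaussian_ruleE mu_nondeg) Qg' xQ'.
  exact: gauss_rule_unique Px Qg' Qg xQ' xQ.
- exact: gauss_rule_noinf Px Qg xQ.
Qed.
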